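(* Let $R$ be a ring. A faithful $R$-module $M$ is an FMS module if and only if the two following conditions are satisfied: (1) $R$ is an FMIR which is a direct product of two rings $R'\times R''$, where $|R'|<\infty$ and $|R''/P|=\infty$ for any $P\in\mathrm{Spec}(R'')$. (2) $M$ is the direct product of a finite $R'$-module and a rank one projective $R''$-module.
   Context: All rings considered are commutative, nonzero and unital. An $R$-module is an FMS module if it has only finitely many $R$-submodules. A ring is an FMIR if it has only finitely many ideals. $\mathrm{Spec}(R'')$ is the set of prime ideals of $R''$, and $|X|$ denotes the cardinality of a set $X$.
   Formalization: The factors R' and R'' are allowed to be the zero ring; with both required to be nonzero the claim fails, e.g. for R = M an infinite field (or a finite field), which is not a product of two nonzero rings. *)

(* Defs.v *)
From HB Require Import structures.
From mathcomp Require Import all_boot all_algebra.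
From mathcomp Require Import boolp classical_sets cardinality.
From mathcomp Require Import ring.
Set Implicit Arguments.
Unset Strict Implicit.
Unset Printing Implicit Defensive.
Import GRing.Theory.
Local Open Scope ring_scope.
Local Open Scope quotient_scope.

(* Rings are comPzRingType's, i.e., they may be zero: a factor of a product
   decomposition may be trivial. A submodule of M is its (boolean) membership
   predicate; by functional extensionality two such predicates are equal if and
   only if they have the same elements. *)

Definition faithful (R : comPzRingType) (M : lmodType R) : Prop :=
  forall a : R, (forall m : M, a *: m = 0) -> a = 0.

Definition is_FMS (R : comPzRingType) (M : lmodType R) : Prop :=
  finite_set [set N : M -> bool | submod_closed N].

(* R^o is R seen as a module over itself: its submodules are the ideals. *)
Definition is_FMIR (R : comPzRingType) : Prop := is_FMS R^o.

Record spec (R : comPzRingType) := Spec {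
  spec_pred :> {pred R};
  spec_ideal : submod_closed (spec_pred : {pred R^o});
  spec_proper : 1 \notin spec_pred;
  spec_prime : forall a b,
    a * b \in spec_pred -> (a \in spec_pred) || (b \in spec_pred)
}.

Section SpecZmod.
Variables (R : comPzRingType) (P : spec R).

Fact spec_zmod_closed : zmod_closed (spec_pred P).
Proof. exact: (GRing.submod_closedB (spec_ideal P)). Qed.

HB.instance Definition _ :=
  GRing.isZmodClosed.Build R (spec_pred P) spec_zmod_closed.

(* The residue ring R / P, as the quotient of the additive group of R. *)
Definition spec_quot : Type := Quotient.quot (spec_pred P).

End SpecZmod.

(* Localization of a module at a prime: classes of fractions m / s, s \notin P,
   where m / s = n / t if and only if u *: (t *: m) = u *: (s *: n) for some
   u \notin P. *)

Section Denominators.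
Variables (R : comPzRingType) (P : spec R).

Definition denom := {s : R | s \notin spec_pred P}.

Definition denom1 : denom := exist _ 1 (spec_proper P).

Fact denom_mul_subproof (s t : denom) : sval s * sval t \notin spec_pred P.
Proof.
by apply/negP => /spec_prime; rewrite (negPf (valP s)) (negPf (valP t)).
Qed.

Definition denom_mul (s t : denom) : denom :=
  exist _ (sval s * sval t) (denom_mul_subproof s t).

End Denominators.

Section Localization.
Variables (R : comPzRingType) (P : spec R) (M : lmodType R).
Implicit Types (m n : M) (s t u : denom P).

Definition loc_rel (x y : M * denom P) : bool :=
  `[< exists u, sval u *: (sval y.2 *: x.1) = sval u *: (sval x.2 *: y.1) >].

Fact loc_rel_refl : reflexive loc_rel.
Proof. by move=> x; apply/asboolP; exists (denom1 P). Qed.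

Fact loc_rel_sym : symmetric loc_rel.
Proof.
by move=> x y; apply/asboolP/asboolP => -[u e]; exists u; rewrite e.
Qed.

Fact loc_rel_trans : transitive loc_rel.
Proof.
move=> [n t] [m s] [p w] /asboolP[u /= e] /asboolP[v /= e'].
apply/asboolP; exists (denom_mul t (denom_mul u v)) => /=.
transitivity ((sval v * sval w) *: (sval u *: (sval t *: m))).
  by rewrite !scalerA; congr (_ *: _); ring.
rewrite e; transitivity ((sval u * sval s) *: (sval v *: (sval w *: n))).
  by rewrite !scalerA; congr (_ *: _); ring.
by rewrite e' !scalerA; congr (_ *: _); ring.
Qed.

Canonical loc_rel_equiv :=
  EquivRel loc_rel loc_rel_refl loc_rel_sym loc_rel_trans.

Definition loc := {eq_quot loc_rel}.

HB.instance Definition _ : EqQuotient _ loc_rel loc := EqQuotient.on loc.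
HB.instance Definition _ := Choice.on loc.

Definition mkloc m s : loc := \pi_loc (m, s).

Lemma mklocP m s n t :
  mkloc m s = mkloc n t <->
  exists u, sval u *: (sval t *: m) = sval u *: (sval s *: n).
Proof.
split=> [/eqmodP/asboolP // | e].
by apply/eqmodP/asboolP.
Qed.

Lemma loc_ind (Q : loc -> Prop) : (forall m s, Q (mkloc m s)) -> forall x, Q x.
Proof. by move=> QP; elim/quotW => -[]. Qed.

Definition loc_add (x y : loc) : loc :=
  let: (m, s) := repr x in let: (n, t) := repr y in
  mkloc (sval t *: m + sval s *: n) (denom_mul s t).

Definition loc_opp (x : loc) : loc := let: (m, s) := repr x in mkloc (- m) s.

Definition loc_zero : loc := mkloc 0 (denom1 P).

Lemma repr_mkloc m s : exists2 n : M, exists t, repr (mkloc m s) = (n, t) &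
  mkloc n (repr (mkloc m s)).2 = mkloc m s.
Proof.
case e : (repr (mkloc m s)) => [n t]; exists n; first by exists t.
by rewrite /= -[RHS]reprK e.
Qed.

Lemma loc_addE m s n t : loc_add (mkloc m s) (mkloc n t) =
  mkloc (sval t *: m + sval s *: n) (denom_mul s t).
Proof.
rewrite /loc_add.
have [m' [s' ->] /= /mklocP[u e]] := repr_mkloc m s.
have [n' [t' ->] /= /mklocP[v e']] := repr_mkloc n t.
apply/mklocP; exists (denom_mul u v) => /=; rewrite !scalerDr; congr (_ + _).
  transitivity ((sval v * sval t * sval t') *: (sval u *: (sval s *: m'))).
    by rewrite !scalerA; congr (_ *: _); ring.
  by rewrite e !scalerA; congr (_ *: _); ring.
transitivity ((sval u * sval s * sval s') *: (sval v *: (sval t *: n'))).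
  by rewrite !scalerA; congr (_ *: _); ring.
by rewrite e' !scalerA; congr (_ *: _); ring.
Qed.

Lemma loc_oppE m s : loc_opp (mkloc m s) = mkloc (- m) s.
Proof.
rewrite /loc_opp; have [m' [s' ->] /= /mklocP[u e]] := repr_mkloc m s.
by apply/mklocP; exists u; rewrite !scalerN e.
Qed.

Fact loc_addA : associative loc_add.
Proof.
elim/loc_ind => m s; elim/loc_ind => n t; elim/loc_ind => p w.
rewrite !loc_addE; apply/mklocP; exists (denom1 P) => /=.
rewrite !scalerDr addrA !scalerA.
by congr (_ *: _ + _ *: _ + _ *: _); ring.
Qed.

Fact loc_addC : commutative loc_add.
Proof.
elim/loc_ind => m s; elim/loc_ind => n t; rewrite !loc_addE addrC.
by congr mkloc; apply: val_inj; rewrite /= mulrC.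
Qed.

Fact loc_add0 : left_id loc_zero loc_add.
Proof.
elim/loc_ind => m s; rewrite loc_addE scaler0 add0r scale1r.
by congr mkloc; apply: val_inj; rewrite /= mul1r.
Qed.

Fact loc_addN : left_inverse loc_zero loc_opp loc_add.
Proof.
elim/loc_ind => m s; rewrite loc_oppE loc_addE scalerN addNr.
by apply/mklocP; exists (denom1 P); rewrite !scaler0.
Qed.

HB.instance Definition _ :=
  GRing.isZmodule.Build loc loc_addA loc_addC loc_add0 loc_addN.

End Localization.

Section LocScale.
Variables (R : comPzRingType) (P : spec R) (M : lmodType R).

Definition loc_scale (a : loc P R^o) (x : loc P M) : loc P M :=
  let: (r, s) := repr a in let: (m, t) := repr x in
  mkloc ((r : R) *: m) (denom_mul s t).

Lemma loc_scaleE (r : R) s m t :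
  loc_scale (mkloc (r : R^o) s) (mkloc m t) = mkloc (r *: m) (denom_mul s t).
Proof.
rewrite /loc_scale.
have [r' [s' ->] /= /mklocP[u e]] := repr_mkloc (r : R^o) s.
have [m' [t' ->] /= /mklocP[v e']] := repr_mkloc m t.
have {}e : sval u * (sval s * (r' : R)) = sval u * (sval s' * r) := e.
apply/mklocP; exists (denom_mul u v) => /=.
transitivity ((sval u * (sval s * (r' : R))) *: (sval v *: (sval t *: m'))).
  by rewrite !scalerA; congr (_ *: _); ring.
by rewrite e e' !scalerA; congr (_ *: _); ring.
Qed.

End LocScale.

Section LocRing.
Variables (R : comPzRingType) (P : spec R).

Definition loc_ring := loc P R^o.

HB.instance Definition _ := GRing.Zmodule.on loc_ring.

Definition loc_mul (a b : loc_ring) : loc_ring := loc_scale a b.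

Definition loc_one : loc_ring := mkloc (1 : R^o) (denom1 P).

Lemma loc_mulE (r r' : R) s s' :
  loc_mul (mkloc (r : R^o) s) (mkloc (r' : R^o) s') =
  mkloc (r * r' : R^o) (denom_mul s s').
Proof. exact: loc_scaleE. Qed.

Fact loc_mulA : associative loc_mul.
Proof.
elim/loc_ind => a s; elim/loc_ind => b t; elim/loc_ind => c w.
by rewrite !loc_mulE mulrA; congr mkloc; apply: val_inj; rewrite /= mulrA.
Qed.

Fact loc_mulC : commutative loc_mul.
Proof.
elim/loc_ind => a s; elim/loc_ind => b t.
rewrite !loc_mulE (mulrC (a : R)).
by congr mkloc; apply: val_inj; rewrite /= mulrC.
Qed.

Fact loc_mul1 : left_id loc_one loc_mul.
Proof.
elim/loc_ind => a s; rewrite loc_mulE mul1r.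
by congr mkloc; apply: val_inj; rewrite /= mul1r.
Qed.

Fact loc_scaleDl (M : lmodType R) (x : loc P M) (a b : loc_ring) :
  loc_scale (a + b) x = loc_scale a x + loc_scale b x.
Proof.
elim/loc_ind: x => m w; elim/loc_ind: a => a s; elim/loc_ind: b => b t.
rewrite [mkloc _ _ + _]loc_addE !loc_scaleE [RHS]loc_addE.
apply/mklocP; exists (denom1 P) => /=.
rewrite scalerDl !scalerDr !scalerA.
by congr (_ *: _ + _ *: _); rewrite /GRing.scale /=; ring.
Qed.

Fact loc_mulDl : left_distributive loc_mul +%R.
Proof. by move=> a b c; apply: loc_scaleDl. Qed.

HB.instance Definition _ := GRing.Zmodule_isComPzRing.Build loc_ring
  loc_mulA loc_mulC loc_mul1 loc_mulDl.

End LocRing.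

Section LocModule.
Variables (R : comPzRingType) (P : spec R) (M : lmodType R).
Implicit Types (a b : loc_ring P) (x y : loc P M).

Fact loc_scaleA a b x : loc_scale a (loc_scale b x) = loc_scale (a * b) x.
Proof.
elim/loc_ind: x => m w; elim/loc_ind: a => a s; elim/loc_ind: b => b t.
rewrite -[_ * _]/(loc_mul _ _) loc_mulE !loc_scaleE scalerA.
by congr mkloc; apply: val_inj; rewrite /= mulrA.
Qed.

Fact loc_scale1 : left_id (1 : loc_ring P) (@loc_scale R P M).
Proof.
elim/loc_ind => m s; rewrite [LHS]loc_scaleE scale1r.
by congr mkloc; apply: val_inj; rewrite /= mul1r.
Qed.

Fact loc_scaleDr : right_distributive (@loc_scale R P M) +%R.
Proof.
elim/loc_ind => a s; elim/loc_ind => m t; elim/loc_ind => n w.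
rewrite [mkloc _ _ + _]loc_addE !loc_scaleE [RHS]loc_addE.
apply/mklocP; exists (denom1 P) => /=.
by rewrite !scalerDr !scalerA; congr (_ *: _ + _ *: _); ring.
Qed.

HB.instance Definition _ :=
  GRing.Zmodule_isLmodule.Build (loc_ring P) (loc P M)
    loc_scaleA loc_scale1 loc_scaleDr (fun x a b => loc_scaleDl x a b).

End LocModule.

Definition fin_generated (R : comPzRingType) (M : lmodType R) : Prop :=
  exists n (e : 'I_n -> M),
    forall m, exists c : 'I_n -> R, m = \sum_(i < n) c i *: e i.

Definition projective (R : comPzRingType) (M : lmodType R) : Prop :=
  forall (A B : lmodType R) (g : {linear A -> B}) (f : {linear M -> B}),
    (forall b, exists a, g a = b) ->
    exists h : {linear M -> A}, forall m, g (h m) = f m.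

(* For every prime P, the localization of M at P is free of rank one over the
   localization of R at P. *)
Definition has_rank_one (R : comPzRingType) (M : lmodType R) : Prop :=
  forall P : spec R,
    exists f : {linear loc P M -> (loc_ring P)^o}, bijective f.

Definition rank_one_projective (R : comPzRingType) (M : lmodType R) : Prop :=
  [/\ fin_generated M, projective M & has_rank_one M].

(* M is isomorphic to M1 x M2 with the R-action transported along phi:
   r (m1, m2) = ((phi r).1 m1, (phi r).2 m2). *)
Definition module_is_prod (R R1 R2 : comPzRingType)
    (phi : {rmorphism R -> (R1 * R2)%type}) (M : lmodType R)
    (M1 : lmodType R1) (M2 : lmodType R2) : Prop :=
  exists psi : {additive M -> (M1 * M2)%type},
    bijective psi /\
    forall r m, psi (r *: m) = ((phi r).1 *: (psi m).1, (phi r).2 *: (psi m).2).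

(* Main.v *)
Require Import Defs.
From HB Require Import structures.
From mathcomp Require Import all_boot all_algebra.
From mathcomp Require Import boolp classical_sets cardinality.
From mathcomp Require Import ring.
Set Implicit Arguments.
Unset Strict Implicit.
Unset Printing Implicit Defensive.
Import GRing.Theory.
Local Open Scope ring_scope.
Local Open Scope classical_set_scope.

(** Let M be faithful with finitely many submodules. The elements m for which
    Rm is finite form a finite set M_f, since M_f is a finite union of finite
    submodules. Its annihilator A has finite index in R, and
    [fms_cofinite_ideal] produces a in 1 + A with aM finite, hence aM inside
    M_f. Then (1 - a)a kills M, so a is an idempotent e, with eM = M_f finite
    and (1 - e)M without nonzero finite submodules ([fms_idempotent]). This
    gives both decompositions at once: R' = eR is finite because it acts
    faithfully on the finite module eM, and R'' = (1 - e)R acts faithfully on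
    M'' = (1 - e)M.

    In R'' no proper ideal has finite index: an ideal of finite index contains
    some 1 - a with aM'' finite, so aM'' = 0 and a = 0 ([cofinite_ideal1]). In
    particular the residue rings of R'' are infinite. Moreover M'' is cyclic
    ([fms_cyclic]), because by B.H. Neumann's covering lemma finitely many
    cosets of proper ideals do not cover R''; being faithful, M'' is isomorphic
    to R''. So M'' is rank one projective, and R'' has as few ideals as M'' has
    submodules.

    Conversely, over R'' with finitely many ideals, a finitely generated module
    M'' that is locally free of rank one is a multiplication module: the
    submodule N is determined by the ideal (N : M'') ([rank_one_fms]). Finally
    the submodules of a product over R' x R'' are the products of submodules,
    and the finite factor has finitely many ([module_prod_fms]). *)

(** * Finite sets *)

Lemma finite_set_inj (T U : Type) (A : set T) (B : set U) (f : T -> U) :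
  finite_set B -> (forall x, A x -> B (f x)) ->
  (forall x y, A x -> A y -> f x = f y -> x = y) -> finite_set A.
Proof.
move=> Bfin fAB f_inj.
have f_inj' : {in A &, injective f}.
  by move=> x y /set_mem Ax /set_mem Ay; exact: f_inj.
rewrite -(eq_finite_set (inj_card_eq f_inj')).
by apply: sub_finite_set Bfin => _ [x Ax <-]; exact: fAB.
Qed.

Lemma finite_set_min (T : choiceType) (le : T -> T -> Prop) (S : set T) :
  (forall x, le x x) -> (forall x y z, le x y -> le y z -> le x z) ->
  finite_set S -> (exists x, S x) ->
  exists2 x, S x & forall y, S y -> le y x -> le x y.
Proof.
move=> le_refl le_trans /finite_seqP[s ->] [x0 /= x0s].
elim: s x0 x0s => // a s IHs _ _.
case: s IHs => [|b s] IHs.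
  exists a => [|y /=]; first by rewrite /= mem_head.
  by rewrite inE => /eqP ->.
have [x xs xmin] := IHs b (mem_head b s).
have [le_ax | nle_ax] := pselect (le a x).
  exists a => [|y]; first by rewrite /= mem_head.
  rewrite /= inE => /predU1P[-> // | ys] le_ya.
  exact: le_trans le_ax (xmin y ys (le_trans _ _ _ le_ya le_ax)).
exists x => [|y]; first by rewrite /= inE [x \in _]xs orbT.
by rewrite /= inE => /predU1P[-> // | ys]; exact: xmin.
Qed.

Lemma finite_range_map (I T U : Type) (F : I -> T -> U) (s : seq T) :
  (forall m, List.In m s -> finite_set (range (F ^~ m))) ->
  finite_set (range (fun i => map (F i) s)).
Proof.
elim: s => [|m s IHs] Fs.
  by apply: (sub_finite_set _ (finite_set1 [::])) => _ [i _ <-].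
have fin_m := Fs m (or_introl erefl).
have fin_s := IHs (fun n sn => Fs n (or_intror sn)).
apply: sub_finite_set (finite_image2 cons fin_m fin_s) => _ [i _ <-] /=.
by exists (F i m); [exists i | exists (map (F i) s); first by exists i].
Qed.

Lemma finite_powerset (T : choiceType) :
  finite_set [set: T] -> finite_set [set: set T].
Proof.
case/finite_seqP=> s sT.
have fin : finite_set (range (fun A : set T => map (fun x => `[< A x >]) s)).
  by apply: finite_range_map => m _; exact: finite_finset.
apply: (finite_set_inj fin) => [A _|A B _ _ eAB]; first by exists A.
apply/funext => x; apply/propext.
have xs : x \in s by have : [set` s] x by rewrite -sT.
move/eq_in_map/(_ x xs): eAB => eAB.
by split=> /asboolP; [rewrite eAB | rewrite -eAB] => /asboolP.
Qed.

(** * Subgroups of finite index *)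

Definition subgroup (G : zmodType) (A : set G) : Prop :=
  A 0 /\ forall a b, A a -> A b -> A (a - b).

(** A has finite index in G, stated through representatives of the cosets so
    that no quotient group is formed. *)
Definition cofinite (G : zmodType) (A : set G) : Prop :=
  exists2 S : set G, finite_set S & forall g, exists2 s, S s & A (g - s).

Lemma cofinite_ker (G : zmodType) (T : choiceType) (f : G -> T) (A : set G) :
  finite_set (range f) -> (forall g h, f g = f h -> A (g - h)) -> cofinite A.
Proof.
move=> fin fA.
have [k kP] : exists k : T -> G, forall g, f (k (f g)) = f g.
  have /choice[k kP] : forall t, exists h, range f t -> f h = t.
    move=> t; have [[h _ fh]|nt] := pselect (range f t); first by exists h.
    by exists 0 => /nt.
  by exists k => g; apply: kP; exists g.
exists (k @` range f) => [|g]; first exact: finite_image.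
by exists (k (f g)); [exists (f g); first by exists g | apply: fA; rewrite kP].
Qed.

(** B.H. Neumann's lemma. If the cosets of the first subgroup C alone do not
    cover, a missed coset of C lies in the union of the cosets of the other
    subgroups; by translation so does every coset of C, and C can be dropped
    from the covering. *)
Lemma neumann (G : zmodType) (I : choiceType) (D : set I) (C : I -> set G) :
  finite_set D -> (forall i, D i -> subgroup (C i)) ->
  (exists2 S : set G, finite_set S &
     forall g, exists2 i, D i & exists2 s, S s & C i (g - s)) ->
  exists2 i, D i & cofinite (C i).
Proof.
move=> /finite_seqP[r ->] Csub;
  elim: r => [|i r IHr] in Csub * => -[S Sfin covS].
  by have [j] := covS 0.
have [cov_i | /existsNP[g0 g0i]] :=
  pselect (forall g, exists2 s, S s & C i (g - s)).
  by exists i; [rewrite /= mem_head | exists S].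
have [j jr||j jr Cj] := IHr; last by exists j => //=;
  rewrite inE [j \in r]jr orbT.
  by apply: Csub; rewrite /= inE [j \in r]jr orbT.
exists (S `|` [set s + t - g0 | s in S & t in S]).
  by rewrite finite_setU; split; rewrite //; exact: finite_image2.
move=> g; have [j + [s Ss Cjs]] := covS g.
rewrite /= inE => /predU1P[ji | jr]; last by exists j => //; exists s; [left|].
have [k + [t St Ckt]] := covS (g0 + (g - s)).
rewrite /= inE => /predU1P[ki | kr].
  case: g0i; exists t => //; rewrite ki ji in Ckt Cjs.
  (* g0 - t is a difference of two elements of C i, so g0 was not missed. *)
  have -> : g0 - t = (g0 + (g - s) - t) - (g - s).
    by rewrite addrAC addrK.
  by apply: (Csub i _).2 => //=; rewrite mem_head.
exists k => //; exists (s + t - g0); first by right; exists s => //; exists t.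
suff -> : g - (s + t - g0) = g0 + (g - s) - t by [].
by rewrite opprB addrCA opprD !addrA.
Qed.

(** * Submodules *)

Section Submodule.
Variables (R : comPzRingType) (M : lmodType R).
Implicit Types (N K : set M) (x y m : M).

Definition submodule N : Prop :=
  N 0 /\ forall (a : R) u v, N u -> N v -> N (a *: u + v).

Definition cyc x : set M := range (fun a : R => a *: x).

Lemma submoduleD N x y : submodule N -> N x -> N y -> N (x + y).
Proof. by move=> [_ sN] Nx Ny; rewrite -[x]scale1r; exact: sN. Qed.

Lemma submoduleZ N (a : R) x : submodule N -> N x -> N (a *: x).
Proof. by move=> [N0 sN] Nx; rewrite -[_ *: _]addr0; exact: sN. Qed.

Lemma submoduleB N x y : submodule N -> N x -> N y -> N (x - y).
Proof.
by move=> sN Nx Ny; rewrite -scaleN1r; apply: submoduleD;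
  last exact: submoduleZ.
Qed.

Lemma cyc_id x : cyc x x.
Proof. by exists 1; rewrite ?scale1r. Qed.

Lemma cyc_submodule x : submodule (cyc x).
Proof.
split=> [|a _ _ [b _ <-] [c _ <-]]; first by exists 0; rewrite ?scale0r.
by exists (a * b + c) => //; rewrite scalerDl scalerA.
Qed.

Lemma cyc_sub N x : submodule N -> N x -> cyc x `<=` N.
Proof. by move=> sN Nx _ [a _ <-]; exact: submoduleZ. Qed.

Lemma is_FMSE : is_FMS M <-> finite_set submodule.
Proof.
split=> fin.
  apply: (finite_set_inj (f := fun N => (fun m => `[< N m >]) : M -> bool) fin).
    move=> N [N0 sN]; split=> [|a u v]; first by apply/asboolP.
    by move=> /asboolP Nu /asboolP Nv; apply/asboolP; exact: sN.
  move=> N N' _ _ eN; apply/funext => m; apply/propext.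
  have {}eN : `[< N m >] = `[< N' m >] := congr1 (@^~ m) eN.
  by split=> /asboolP; [rewrite eN | rewrite -eN] => /asboolP.
apply: (finite_set_inj (f := fun N : M -> bool => [set m | N m]) fin).
  by move=> N [N0 sN]; split=> // a u v; exact: sN.
move=> N N' _ _ eN; apply/funext => m; apply/idP/idP.
  by have : [set m | N m] m -> [set m | N' m] m by rewrite eN.
by have : [set m | N' m] m -> [set m | N m] m by rewrite eN.
Qed.

Hypothesis fmsM : is_FMS M.

Lemma fms_minimal (Q : set M -> Prop) : (exists2 N, submodule N & Q N) ->
  exists N, [/\ submodule N, Q N &
    forall N', submodule N' -> Q N' -> N' `<=` N -> N `<=` N'].
Proof.
move=> [N0 sN0 QN0].
have fin : finite_set (submodule `&` Q).
  by apply: sub_finite_set (is_FMSE.1 fmsM) => N [].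
have [||N [sN QN] Nmin] := finite_set_min (@subset_refl M) _ fin.
- by move=> A B C; exact: subset_trans.
- by exists N0.
by exists N; split=> // N' sN' QN'; exact: Nmin.
Qed.

Lemma fms_maximal (Q : set M -> Prop) : (exists2 N, submodule N & Q N) ->
  exists N, [/\ submodule N, Q N &
    forall N', submodule N' -> Q N' -> N `<=` N' -> N' `<=` N].
Proof.
move=> [N0 sN0 QN0].
have fin : finite_set (submodule `&` Q).
  by apply: sub_finite_set (is_FMSE.1 fmsM) => N [].
have [|||N [sN QN] Nmax] := finite_set_min (le := fun A B => B `<=` A) _ _ fin.
- exact: subset_refl.
- by move=> A B C sBA sCB; exact: subset_trans sCB sBA.
- by exists N0.
by exists N; split=> // N' sN' QN'; exact: Nmax.
Qed.

Lemma fms_finite_cyc : finite_set [set m : M | finite_set (cyc m)].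
Proof.
have fin : finite_set (submodule `&` (@finite_set M)).
  by apply: sub_finite_set (is_FMSE.1 fmsM) => N [].
have := bigcup_finite fin (fun (N : set M) sN => sN.2).
apply: sub_finite_set => m mfin; exists (cyc m); last exact: cyc_id.
by split=> //; exact: cyc_submodule.
Qed.

End Submodule.

(** The action of r on the elements of D takes finitely many values, and r is
    determined by it up to the annihilator of D. *)
Lemma cofinite_ann (R : comPzRingType) (M : lmodType R) (D : set M) :
  finite_set D -> (forall m, D m -> finite_set (cyc m)) ->
  cofinite [set r : R | forall m, D m -> r *: m = 0].
Proof.
move=> /finite_seqP[s ->] fin_s.
apply: (cofinite_ker (f := fun r : R => map (fun m => r *: m) s)).
  apply: finite_range_map => m sm; apply: fin_s => /=.
  by elim: s sm => //= n s IHs [-> | /IHs]; rewrite inE ?eqxx // => ->;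
    rewrite orbT.
by move=> r t /eq_in_map rt m /= /rt e; rewrite scalerBl e subrr.
Qed.

(** For a suitable a in 1 + A, aM is the part of M supported at the primes
    containing A, and the residue fields of these primes are finite.
    Choosing a in 1 + A with maximal kernel makes every element of 1 + A act
    injectively on aM. If aM were infinite, a minimal infinite submodule K of
    it would be cyclic, K = Rx, because M has only finitely many elements
    spanning a finite submodule; Ax has finite index in Rx, so Ax = Rx by
    minimality, and x = rx with r in A contradicts injectivity of 1 - r. *)
Lemma fms_cofinite_ideal (R : comPzRingType) (M : lmodType R)
    (A : set R^o) :
  is_FMS M -> submodule A -> cofinite (A : set R) ->
  exists2 a : R, A (1 - a) & finite_set (range (fun m : M => a *: m)).
Proof.
move=> fmsM sA [S Sfin covS].
have A1M (a b : R) : A (1 - a) -> A (1 - b) -> A (1 - b * a).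
  move=> Aa Ab; have -> : 1 - b * a = b * (1 - a) + (1 - b) by ring.
  exact: sA.2.
have [|_ [_ [a Aa ->] kmax]] := @fms_maximal _ _ fmsM
  (fun K => exists2 a : R, A (1 - a) & K = [set m : M | a *: m = 0]).
  exists [set m : M | (1 : R) *: m = 0].
    split=> [|b u v /= Nu Nv]; first by rewrite /= scaler0.
    rewrite scale1r in Nu; rewrite scale1r in Nv.
    by rewrite Nu Nv scaler0 addr0 scaler0.
  by exists 1; rewrite ?subrr //; exact: sA.1.
have inj_aM (b : R) (m : M) : A (1 - b) -> b *: (a *: m) = 0 -> a *: m = 0.
  move=> Ab bam.
  suff ker_ba :
    [set m : M | (b * a) *: m = 0] `<=` [set m : M | a *: m = 0].
    by apply: ker_ba; rewrite /= -scalerA.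
  apply: kmax.
  - split=> [|c u v /= Nu Nv]; first by rewrite /= scaler0.
    rewrite /= scalerDr Nv addr0.
    by rewrite scalerA (mulrC (b * a)) -(scalerA c) Nu scaler0.
  - by exists (b * a) => //; exact: A1M.
  - by move=> u /= au; rewrite -scalerA au scaler0.
exists a => //; apply: contrapT => inf_aM.
have [|K [sK [K_inf KaM] Kmin]] := @fms_minimal _ _ fmsM
  (fun K => infinite_set K /\ K `<=` range (fun m : M => a *: m)).
  exists (range (fun m : M => a *: m)); last by split.
  split=> [|b _ _ [u _ <-] [v _ <-]]; first by exists 0; rewrite ?scaler0.
  by exists (b *: u + v) => //; rewrite scalerDr !scalerA mulrC.
have [x Kx x_inf] : exists2 x, K x & infinite_set (cyc x).
  apply: contrapT => nx; apply: K_inf.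
  apply: sub_finite_set (fms_finite_cyc fmsM) => x Kx /=.
  by apply: contrapT => x_inf; apply: nx; exists x.
pose Ax : set M := [set (r : R) *: x | r in A].
have sAx : submodule Ax.
  split=> [|b _ _ [r Ar <-] [t At <-]].
    by exists 0; [exact: sA.1 | rewrite scale0r].
  by exists (b * r + t); [exact: sA.2 | rewrite scalerDl scalerA].
have AxK : Ax `<=` K by move=> _ [r _ <-]; exact: submoduleZ.
have Ax_inf : infinite_set Ax.
  (* Rx is the union of the translates s x + Ax, with s in S. *)
  move=> Ax_fin; apply: x_inf.
  have := finite_image2 (fun (s : R) (y : M) => s *: x + y) Sfin Ax_fin.
  apply: sub_finite_set => _ [r _ <-]; have [s Ss Ars] := covS r.
  exists s => //; exists ((r - s) *: x); first by exists (r - s).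
  by rewrite -scalerDl addrCA subrr addr0.
have [r Ar rx] : Ax x.
  by apply: (Kmin Ax) => //; split=> //; exact: subset_trans KaM.
have [m _ mx] := KaM x Kx.
have x0 : x = 0.
  rewrite -mx; apply: (inj_aM (1 - r)); first by rewrite subKr.
  by rewrite mx scalerBl scale1r rx subrr.
apply: x_inf; rewrite x0; apply: sub_finite_set (finite_set1 0).
by move=> _ [t _ <-] /=; rewrite scaler0.
Qed.

(** * Faithful modules without nonzero finite submodules *)

Section NoFiniteSubmodule.
Variables (R : comPzRingType) (M : lmodType R).
Hypotheses (fmsM : is_FMS M) (faithM : faithful M).
Hypothesis cyc_inf : forall m : M, finite_set (cyc m) -> m = 0.

(** Some a in 1 + A has aM finite, so aM = 0 and a = 0. *)
Lemma cofinite_ideal1 (A : set R^o) :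
  submodule A -> cofinite (A : set R) -> A (1 : R).
Proof.
move=> sA cofA; have [a Aa aM_fin] := fms_cofinite_ideal fmsM sA cofA.
suff a0 : a = 0 by rewrite a0 subr0 in Aa.
apply: faithM => m; apply: cyc_inf; apply: sub_finite_set aM_fin.
by move=> _ [r _ <-]; exists (r *: m) => //; rewrite !scalerA mulrC.
Qed.

Lemma spec_quot_infinite (P : spec R) : infinite_set [set: spec_quot P].
Proof.
move=> fin; have /negP[] := spec_proper P.
have [P0 linP] := spec_ideal P.
apply: (@cofinite_ideal1 [set r | r \in spec_pred P]); first by split.
apply: (cofinite_ker (f := \pi_(spec_quot P)%qT)).
  exact: sub_finite_set fin.
by move=> g h /eqP; rewrite -Quotient.idealrBE.
Qed.

(** A ring without proper ideals of finite index is not covered by finitely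
    many cosets of proper ideals. Let Rx be maximal among cyclic submodules.
    For y in M, finitely many submodules T are of the form R(x + ry), and if
    R(x + ry) = R(x + sy) = T then (r - s)y lies in T: so cosets of the ideals
    (T : y) cover R, one of these ideals is R, and then T contains y and x, so
    that T = Rx by maximality. *)
Lemma fms_cyclic : exists x : M, forall m, cyc x m.
Proof.
have [|_ [_ [x ->] xmax]] := @fms_maximal _ _ fmsM
  (fun N => exists x, N = cyc x).
  by exists (cyc 0); [exact: cyc_submodule | exists 0].
exists x => y.
pose D := [set T | exists r : R, T = cyc (x + r *: y)].
have Dsub T : D T -> submodule T by move=> [r ->]; exact: cyc_submodule.
have /choice[k kP] : forall T, exists r : R, D T -> T = cyc (x + r *: y).
  move=> T; have [[r ->]|nT] := pselect (D T); first by exists r.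
  by exists 0 => /nT.
have Dfin : finite_set D by exact: sub_finite_set Dsub ((is_FMSE M).1 fmsM).
have [||T DT cofT] := neumann (C := fun T => [set t : R | T (t *: y)]) Dfin.
- move=> T /Dsub sT; split=> [|a b /= Ta Tb]; first by rewrite /= scale0r;
  case: sT.
  by rewrite /= scalerBl; exact: submoduleB.
- exists (k @` D) => [|r]; first exact: finite_image.
  have Dr : D (cyc (x + r *: y)) by exists r.
  have sDr := Dsub _ Dr; have := kP _ Dr; set T := cyc _ => eT.
  exists T => //; exists (k T) => /=; first by exists T.
  have -> : (r - k T) *: y = (x + r *: y) - (x + k T *: y).
    by rewrite opprD addrACA subrr add0r scalerBl.
  by apply: submoduleB => //; [exact: cyc_id | rewrite {1}eT; exact: cyc_id].
have sT := Dsub T DT.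
have Ty : T y.
  rewrite -[y]scale1r.
  apply: (@cofinite_ideal1 [set t : R | T (t *: y)]) => //.
  split=> [|a b c /= Tb Tc]; first by rewrite /= scale0r; case: sT.
  by rewrite /= scalerDl -scalerA; exact: sT.2.
have [r eT] := DT.
have Tx : T x.
  have -> : x = (x + r *: y) - r *: y by rewrite addrK.
  by apply: submoduleB => //; [rewrite eT; exact: cyc_id | exact: submoduleZ].
apply: (xmax T) => //; last exact: cyc_sub.
by exists (x + r *: y).
Qed.

End NoFiniteSubmodule.

(** * Rank one projective modules *)

Section LocMap.
Variables (R : comPzRingType) (P : spec R) (M N : lmodType R).

Definition loc_map (v : {linear M -> N}) (x : loc P M) : loc P N :=
  let: (m, s) := repr x in mkloc (v m) s.

Lemma loc_mapE (v : {linear M -> N}) m s :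
  loc_map v (mkloc m s) = mkloc (v m) s.
Proof.
rewrite /loc_map; have [n [t ->] /= /mklocP[u e]] := repr_mkloc m s.
have vZ (a : R) z : v (a *: z) = a *: v z by exact: linearZ.
by apply/mklocP; exists u; rewrite -!vZ e.
Qed.

Lemma loc_map_linear (v : {linear M -> N}) : linear (loc_map v).
Proof.
move=> a x y; rewrite -[_ *: x]/(loc_scale a x).
rewrite -[a *: loc_map v x]/(loc_scale a (loc_map v x)).
elim/loc_ind: a => a s; elim/loc_ind: x => m t; elim/loc_ind: y => n w.
rewrite loc_scaleE !loc_mapE loc_scaleE [mkloc _ _ + _]loc_addE.
have vZ (b : R) z : v (b *: z) = b *: v z by exact: linearZ.
by rewrite [RHS]loc_addE loc_mapE linearD !vZ.
Qed.

End LocMap.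

(** A module isomorphic to the ring is rank one projective: a map out of it is
    lifted by lifting the image of the generator. *)
Lemma free_rank_one_projective (R : comPzRingType) (M : lmodType R)
    (v : {linear M -> R^o}) : bijective v -> rank_one_projective M.
Proof.
case=> w vK wK.
have w_lin : linear w := can2_linear vK wK.
pose wL : {linear R^o -> M} := HB.pack w (GRing.isLinear.Build _ _ _ _ w w_lin).
have wZ (r : R) (z : R^o) : w (r *: z) = r *: w z 
  by have w_sc : scalable w := GRing.scalable_linear w_lin; exact: w_sc.
have mE m : m = (v m : R) *: w (1 : R).
  by rewrite -wZ /GRing.scale /= mulr1 vK.
split.
- exists 1%N, (fun=> w (1 : R)) => m; exists (fun=> v m).
  by rewrite big_ord1 -mE.
- move=> A B g f g_surj; have [a ga] := g_surj (f (w (1 : R))).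
  pose h m : A := (v m : R) *: a.
  have h_lin : linear h.
    by move=> r m n; rewrite /h linearP scalerDl -scalerA.
  pose hL : {linear M -> A} := HB.pack h (GRing.isLinear.Build _ _ _ _ h h_lin).
  have fZ (r : R) z : f (r *: z) = r *: f z by exact: linearZ.
  have gZ (r : R) z : g (r *: z) = r *: g z by exact: linearZ.
  by exists hL => m; rewrite /= /h gZ ga -fZ -mE.
move=> P; pose f : loc P M -> (loc_ring P)^o := loc_map v.
have f_lin : linear f := loc_map_linear v.
pose fL : {linear loc P M -> (loc_ring P)^o} :=
  HB.pack f (GRing.isLinear.Build _ _ _ _ f f_lin).
exists fL, (loc_map wL); elim/loc_ind => m s.
  by rewrite /= /f !loc_mapE /= vK.
by rewrite /= /f !loc_mapE /= wK.
Qed.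

Section LocallyCyclic.
Variables (R : comPzRingType) (M : lmodType R).

(** A generator of M_P over R_P is a fraction x / t; as t becomes a unit in R_P,
    the numerator x generates M_P as well. *)
Lemma rank_one_loc_gen (P : spec R) : has_rank_one M ->
  exists x : M, forall m, exists2 s : R, s \notin spec_pred P & cyc x (s *: m).
Proof.
case/(_ P) => f [g fK gK].
have [x [t gt]] : exists x : M, exists t, g (1 : loc_ring P) = mkloc x t.
  by elim/loc_ind: (g _) => x t; exists x, t.
exists x => m.
have [a [s fm]] : exists a :
  R, exists s, f (mkloc m (denom1 P)) = mkloc (a : R^o) s.
  by elim/loc_ind: (f _) => a s; exists a, s.
have : mkloc m (denom1 P) = loc_scale (mkloc (a : R^o) s) (mkloc x t).
  rewrite -gt -fm; apply: (can_inj fK).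
  have fZ (b : loc_ring P) z : f (loc_scale b z) = b * f z by exact: linearZ.
  by rewrite fZ gK mulr1.
rewrite loc_scaleE => /mklocP[u] /=; rewrite scale1r scalerA => e.
exists (sval u * (sval s * sval t)).
  exact: (valP (denom_mul u (denom_mul s t))).
by rewrite e scalerA; exists (sval u * a).
Qed.

(** The denominators needed for finitely many generators of M multiply to one
    that serves for all of M. *)
Lemma rank_one_uniform_denom (P : spec R) : fin_generated M -> has_rank_one M ->
  exists x : M, exists2 s : R, s \notin spec_pred P & forall m, cyc x (s *: m).
Proof.
move=> [n [e eM]] /(@rank_one_loc_gen P)[x xP]; exists x.
have /choice[s sP] : forall i, exists s : R,
    s \notin spec_pred P /\ cyc x (s *: e i).
  by move=> i; have [s ? ?] := xP (e i); exists s.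
exists (\prod_i s i) => [|m].
  elim/big_ind: _ => [|a b aP bP|i _]; first exact: spec_proper.
    by apply/negP => /spec_prime; rewrite (negPf aP) (negPf bP).
  by case: (sP i).
have [c ->] := eM m; rewrite scaler_sumr.
have sx := cyc_submodule x.
apply: (big_ind (cyc x)) => [|y z yx zx|i _]; first exact: sx.1.
  exact: submoduleD.
rewrite scalerA (bigD1 i) //= -mulrA mulrC -scalerA.
by apply: submoduleZ => //; case: (sP i).
Qed.

End LocallyCyclic.

(** Finiteness of the set of ideals yields a maximal one among the proper
    ideals containing J, and maximal ideals are prime. *)
Lemma ideal_sub_spec (R : comPzRingType) (J : set R^o) :
  is_FMIR R -> submodule J -> ~ J (1 : R) ->
  exists P : spec R, forall a : R, J a -> a \in spec_pred P.
Proof.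
move=> fmsR sJ J1.
have [|P [sP [JP P1] Pmax]] := @fms_maximal _ _ fmsR
  (fun P : set R^o => J `<=` P /\ ~ P (1 : R)); first by exists J;
    last by split.
have Pprime (a b : R) : P (a * b) -> P a \/ P b.
  move=> Pab; have [Pa | nPa] := pselect (P a); [by left | right].
  (* Q is the ideal P + Ra. *)
  pose Q : set R^o := [set p | exists2 q, P q & exists r : R, p = q + r * a].
  have PQ : P `<=` Q by move=> q Pq; exists q => //; exists 0;
    rewrite mul0r addr0.
  have sQ : submodule Q.
    split=> [|c _ _ [p Pp [r ->]] [q Pq [t ->]]]; first by apply: PQ; case: sP.
    exists (c *: p + q); first exact: sP.2.
    by exists (c * r + t); rewrite /GRing.scale /=; ring.
  have [q Pq [r e1]] : Q (1 : R).
    apply: contrapT => Q1; apply: nPa; apply: (Pmax Q) => //.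
      by split=> //; exact: subset_trans PQ.
    by exists 0; [case: sP | exists 1; rewrite mul1r add0r].
  have -> : b = b *: (q : R^o) + r *: ((a * b : R) : R^o).
    by rewrite /GRing.scale /= -[LHS]mulr1 e1; ring.
  by apply: submoduleD => //; exact: submoduleZ.
have [P0 linP] := sP.
pose p : {pred R} := fun r => `[< P r >].
have p_submod : submod_closed (p : {pred R^o}).
  split=> [|a u v /asboolP Pu /asboolP Pv]; first by apply/asboolP.
  by apply/asboolP; exact: linP.
have p_proper : 1 \notin p by apply/asboolP.
have p_prime a b : a * b \in p -> (a \in p) || (b \in p).
  by move=> /asboolP/Pprime[?|?]; apply/orP; [left | right]; apply/asboolP.
by exists (Spec p_submod p_proper p_prime) => a Ja; apply/asboolP; exact: JP.
Qed.

(** A locally cyclic finitely generated module is a multiplication module: a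
    submodule N is recovered from the ideal (N : M). Indeed, if sM is in Rx
    with s outside P, then m in N gives sm = rx with rs in (N : M), so s^2 m
    lies in every submodule N' with (N : M) contained in (N' : M); thus the
    ideal of all t with tm in N' is contained in no prime P. *)
Lemma rank_one_fms (R : comPzRingType) (M : lmodType R) :
  is_FMIR R -> fin_generated M -> has_rank_one M -> is_FMS M.
Proof.
move=> fmsR genM rkM; apply/is_FMSE.
pose colon (N : set M) : set R^o := [set r : R | forall m : M, N (r *: m)].
have colonI N N' : submodule N -> submodule N' ->
    colon N `<=` colon N' -> N `<=` N'.
  move=> sN sN' cNN' m Nm.
  pose J : set R^o := [set r : R | N' (r *: m)].
  have sJ : submodule J.
    split=> [|a b c /= Jb Jc]; first by rewrite /J /= scale0r; case: sN'.
    by rewrite /J /= scalerDl -scalerA; exact: sN'.2.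
  rewrite -[m]scale1r; apply: contrapT => J1.
  have [P JP] := ideal_sub_spec fmsR sJ J1.
  have [x [s sP sx]] := rank_one_uniform_denom P genM rkM.
  have [r _ rx] := sx m.
  suff /JP/spec_prime : J (s * s) by rewrite (negPf sP).
  rewrite /J /= -scalerA -rx scalerA mulrC.
  apply: cNN' => n; rewrite -scalerA; have [t _ <-] := sx n.
  rewrite scalerA mulrC -scalerA rx.
  by apply: submoduleZ => //; exact: submoduleZ.
apply: (finite_set_inj (f := colon) ((is_FMSE R^o).1 fmsR)).
  move=> N sN; split=> [m|a b c /= cb cc m]; first by rewrite scale0r; case: sN.
  by rewrite scalerDl -scalerA; apply: sN.2.
move=> N N' sN sN' e; apply/seteqP.
by split; apply: colonI; rewrite // e.
Qed.

(** * Products *)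

Section Product.
Variables (R R1 R2 : comPzRingType) (phi : {rmorphism R -> (R1 * R2)%type}).

Lemma module_prod_fms_snd (M : lmodType R) (M1 : lmodType R1)
    (M2 : lmodType R2) :
  module_is_prod phi M M1 M2 -> is_FMS M -> is_FMS M2.
Proof.
move=> [psi [[chi psiK chiK] psiZ]] /is_FMSE fin; apply/is_FMSE.
apply: (finite_set_inj (f := fun N : set M2 => [set m | N (psi m).2]) fin).
  move=> N sN; split=> [|a u v /= Nu Nv]; first by rewrite /= raddf0;
    exact: sN.1.
  by rewrite /= raddfD psiZ; exact: sN.2.
have image N : N = [set y | [set m | N (psi m).2] (chi (0, y))].
  by apply/funext => y; rewrite /= chiK.
by move=> N N' _ _ e; rewrite (image N) (image N') e.
Qed.

(** The idempotents of R cut a submodule N of M into two pieces, and N is the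
    sum of the pieces. *)
Lemma module_prod_fms (M : lmodType R) (M1 : lmodType R1) (M2 : lmodType R2) :
  bijective phi -> module_is_prod phi M M1 M2 ->
  finite_set [set: M1] -> is_FMS M2 -> is_FMS M.
Proof.
move=> [phi' _ phiK] [psi [[chi psiK chiK] psiZ]] fin1 /is_FMSE fin2.
apply/is_FMSE.
pose r := phi' (1, 0).
have splitN N m : submodule N ->
    N m <-> N (chi ((psi m).1, 0)) /\ N (chi (0, (psi m).2)).
  move=> sN; have e1 : chi ((psi m).1, 0) = r *: m.
    by rewrite -[RHS]psiK psiZ phiK scale1r scale0r.
  have e2 : chi (0, (psi m).2) = (1 - r) *: m.
    by rewrite -[RHS]psiK psiZ rmorphB rmorph1 phiK /= subrr subr0 scale0r
      scale1r.
  rewrite e1 e2; split=> [Nm | [N1 N2]]; first by split; exact: submoduleZ.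
  rewrite -[m]scale1r -(subrK r 1) scalerDl; exact: submoduleD.
have chiD x y : chi (x + y) = chi x + chi y.
  by apply: (can_inj psiK); rewrite raddfD /= !chiK.
have chi0 : chi 0 = 0 by apply: (can_inj psiK); rewrite raddf0 chiK.
pose f (N : set M) : set M1 * set M2 :=
  ([set x | N (chi (x, 0))], [set y | N (chi (0, y))]).
apply: (finite_set_inj (f := f) (finite_setX (finite_powerset fin1) fin2)).
  move=> N sN; split=> //; split=> [|a u v /= Nu Nv].
    by rewrite /f /= [chi _]chi0; exact: sN.1.
  have -> : chi (0, a *: u + v) = phi' (0, a) *: chi (0, u) + chi (0, v).
    apply: (can_inj psiK).
    by rewrite raddfD /= psiZ phiK !chiK scaler0; congr pair; rewrite /= addr0.
  exact: sN.2.
move=> N N' sN sN' [e1 e2]; apply/funext => m; apply/propext.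
rewrite (splitN N) // (splitN N') //.
have -> : N (chi ((psi m).1, 0)) = N' (chi ((psi m).1, 0)).
  exact: (congr1 (@^~ (psi m).1) e1).
by have -> : N (chi (0, (psi m).2)) = N' (chi (0, (psi m).2))
  by exact: (congr1 (@^~ (psi m).2) e2).
Qed.

Lemma regular_is_prod : bijective phi -> module_is_prod phi R^o R1^o R2^o.
Proof.
move=> phi_bij; exists (phi : {additive R^o -> (R1^o * R2^o)%type}).
by split=> // r m; rewrite -[r *: m]/(r * (m : R)) /= rmorphM.
Qed.

End Product.

(** * The pieces cut out by an idempotent *)

Record idempotent (R : comPzRingType) :=
  Idempotent { idem_val :> R; idemP : idem_val * idem_val = idem_val }.

Section CornerModule.
Variables (R : comPzRingType) (e : idempotent R) (M : lmodType R).

(** The submodule eM, as the set of fixed points of e. *)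
Record corner :=
  Corner { corner_val : M; corner_valP : (e : R) *: corner_val == corner_val }.

HB.instance Definition _ := [isSub for corner_val].
HB.instance Definition _ := [Choice of corner by <:].

Fact corner_proj_subproof (m : M) : (e : R) *: ((e : R) *: m) == (e : R) *: m.
Proof. by rewrite scalerA idemP. Qed.

Definition corner_proj m : corner := Corner (corner_proj_subproof m).

Lemma corner_val_inj : injective corner_val.
Proof. exact: val_inj. Qed.

Lemma corner_valK (x : corner) : (e : R) *: corner_val x = corner_val x.
Proof. exact/eqP/corner_valP. Qed.

Definition corner_add (x y : corner) :=
  corner_proj (corner_val x + corner_val y).
Definition corner_opp (x : corner) := corner_proj (- corner_val x).

Fact corner_addA : associative corner_add.
Proof.
by move=> x y z; apply: corner_val_inj; rewrite /= !scalerDr !corner_valK addrA.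
Qed.

Fact corner_addC : commutative corner_add.
Proof. by move=> x y; apply: corner_val_inj; rewrite /= addrC. Qed.

Fact corner_add0 : left_id (corner_proj 0) corner_add.
Proof.
by move=> x; apply: corner_val_inj; rewrite /= scaler0 add0r corner_valK.
Qed.

Fact corner_addN : left_inverse (corner_proj 0) corner_opp corner_add.
Proof.
by move=> x; apply: corner_val_inj; rewrite /= scalerN corner_valK addNr.
Qed.

HB.instance Definition _ :=
  GRing.isZmodule.Build corner corner_addA corner_addC corner_add0 corner_addN.

Lemma corner_valD (x y : corner) :
  corner_val (x + y) = corner_val x + corner_val y.
Proof. by rewrite /= scalerDr !corner_valK. Qed.

Lemma corner_val0 : corner_val 0 = 0.
Proof. exact: scaler0. Qed.

Lemma corner_projB : {morph corner_proj : m n / m - n}.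
Proof.
by move=> m n; apply: corner_val_inj;
  rewrite corner_valD /= !scalerN scalerA idemP scalerBr.
Qed.

HB.instance Definition _ :=
  GRing.isZmodMorphism.Build M corner corner_proj corner_projB.

End CornerModule.

Section CornerRing.
Variables (R : comPzRingType) (e : idempotent R).

(** The ring eR, with unit e. *)
Definition corner_ring := corner e R^o.

HB.instance Definition _ := GRing.Zmodule.on corner_ring.

Implicit Types x y z : corner_ring.

Definition corner_mul x y : corner_ring :=
  corner_proj e ((corner_val x : R) * corner_val y : R^o).

Lemma corner_ring_valK x : (e : R) * (corner_val x : R) = corner_val x.
Proof. exact: (@corner_valK R e R^o x). Qed.

Lemma corner_mulE x y :
  corner_val (corner_mul x y) = (corner_val x : R) * corner_val y.
Proof. by rewrite /= [LHS]mulrA corner_ring_valK. Qed.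

Fact corner_mulA : associative corner_mul.
Proof. by move=> x y z; apply: corner_val_inj; rewrite !corner_mulE mulrA. Qed.

Fact corner_mulC : commutative corner_mul.
Proof. by move=> x y; apply: corner_val_inj;
  rewrite /= (mulrC (corner_val x : R)). Qed.

Fact corner_mul1 : left_id (corner_proj e (1 : R^o)) corner_mul.
Proof.
move=> x; apply: corner_val_inj; rewrite !corner_mulE -[RHS]corner_ring_valK.
by congr (_ * _); exact: mulr1.
Qed.

Fact corner_mulDl : left_distributive corner_mul +%R.
Proof.
move=> x y z; apply: corner_val_inj.
by rewrite !(corner_mulE, corner_valD) mulrDl.
Qed.

HB.instance Definition _ := GRing.Zmodule_isComPzRing.Build corner_ring
  corner_mulA corner_mulC corner_mul1 corner_mulDl.

Lemma corner_val1 : corner_val (1 : corner_ring) = (e : R).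
Proof. exact: mulr1. Qed.

Definition corner_ring_proj (r : R) : corner_ring := corner_proj e (r : R^o).

Fact corner_ring_projB : {morph corner_ring_proj : r s / r - s}.
Proof. by move=> r s; exact: (@corner_projB R e R^o r s). Qed.

Fact corner_ring_projM : monoid_morphism corner_ring_proj.
Proof.
split=> // r s; apply: corner_val_inj;
  rewrite [RHS]corner_mulE /= /GRing.scale /=.
by rewrite mulrACA idemP.
Qed.

HB.instance Definition _ :=
  GRing.isZmodMorphism.Build R corner_ring corner_ring_proj corner_ring_projB.
HB.instance Definition _ :=
  GRing.isMonoidMorphism.Build R corner_ring corner_ring_proj corner_ring_projM.

Variable M : lmodType R.

Definition corner_scale (r : corner_ring) (x : corner e M) : corner e M :=
  corner_proj e ((corner_val r : R) *: corner_val x).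

Lemma corner_scaleE r (x : corner e M) :
  corner_val (corner_scale r x) = (corner_val r : R) *: corner_val x.
Proof. by rewrite /= scalerA corner_ring_valK. Qed.

Fact corner_scaleA r s (x : corner e M) :
  corner_scale r (corner_scale s x) = corner_scale (r * s) x.
Proof. by apply: corner_val_inj;
  rewrite !corner_scaleE scalerA corner_mulE. Qed.

Fact corner_scale1 : left_id (1 : corner_ring) corner_scale.
Proof.
by move=> x; apply: corner_val_inj;
  rewrite !corner_scaleE corner_val1 corner_valK.
Qed.

Fact corner_scaleDr : right_distributive corner_scale +%R.
Proof.
by move=> r x y; apply: corner_val_inj;
  rewrite !(corner_scaleE, corner_valD) scalerDr.
Qed.

Fact corner_scaleDl (x : corner e M) : {morph corner_scale^~ x : r s / r + s}.
Proof.
by move=> r s; apply: corner_val_inj;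
  rewrite !(corner_scaleE, corner_valD) scalerDl.
Qed.

HB.instance Definition _ := GRing.Zmodule_isLmodule.Build
  corner_ring (corner e M)
  corner_scaleA corner_scale1 corner_scaleDr corner_scaleDl.

Lemma corner_projZ (r : R) (m : M) :
  corner_proj e (r *: m) = corner_ring_proj r *: corner_proj e m.
Proof.
rewrite -[RHS]/(corner_scale _ _).
apply: corner_val_inj; rewrite corner_scaleE /= !scalerA.
by congr (_ *: m); rewrite /GRing.scale /= mulrAC idemP.
Qed.

End CornerRing.

Section CornerDecomposition.
Variables (R : comPzRingType) (e : idempotent R).

Fact idem_compl_subproof : (1 - (e : R)) * (1 - (e : R)) = 1 - (e : R).
Proof. by rewrite mulrBr mulr1 mulrBl mul1r idemP subrr subr0. Qed.

Definition idem_compl := Idempotent idem_compl_subproof.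

Definition corner_pair (M : lmodType R) (m : M) :
  (corner e M * corner idem_compl M)%type :=
  (corner_proj e m, corner_proj idem_compl m).

Lemma corner_pair_bij (M : lmodType R) : bijective (@corner_pair M).
Proof.
have eC0 (m : M) : (e : R) *: ((1 - (e : R)) *: m) = 0.
  by rewrite scalerA mulrBr mulr1 idemP subrr scale0r.
have Ce0 (m : M) : (1 - (e : R)) *: ((e : R) *: m) = 0.
  by rewrite scalerA mulrBl mul1r idemP subrr scale0r.
exists (fun x => corner_val x.1 + corner_val x.2) => [m|[x y]] /=.
  by rewrite -scalerDl addrC subrK scale1r.
have yK : (1 - (e : R)) *: corner_val y = corner_val y := corner_valK y.
congr pair; apply: corner_val_inj; rewrite /= scalerDr.
  by rewrite corner_valK -yK eC0 addr0.
by rewrite yK -(corner_valK x) Ce0 add0r.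
Qed.

Definition corner_ring_pair (r : R) :
  (corner_ring e * corner_ring idem_compl)%type :=
  (corner_ring_proj e r, corner_ring_proj idem_compl r).

Fact corner_ring_pairB : {morph corner_ring_pair : r s / r - s}.
Proof. by move=> r s; rewrite /corner_ring_pair !rmorphB. Qed.

Fact corner_ring_pairM : monoid_morphism corner_ring_pair.
Proof.
by split=> [|r s]; rewrite /corner_ring_pair ?rmorph1 ?rmorphM.
Qed.

HB.instance Definition _ := GRing.isZmodMorphism.Build R
  (corner_ring e * corner_ring idem_compl)%type corner_ring_pair
  corner_ring_pairB.
HB.instance Definition _ := GRing.isMonoidMorphism.Build R
  (corner_ring e * corner_ring idem_compl)%type corner_ring_pair
  corner_ring_pairM.

Fact corner_pairB (M : lmodType R) : {morph @corner_pair M : m n / m - n}.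
Proof. by move=> m n; rewrite /corner_pair !raddfB. Qed.

HB.instance Definition _ (M : lmodType R) := GRing.isZmodMorphism.Build M
  (corner e M * corner idem_compl M)%type (@corner_pair M) (@corner_pairB M).

Lemma corner_is_prod (M : lmodType R) :
  module_is_prod corner_ring_pair M (corner e M) (corner idem_compl M).
Proof.
exists (@corner_pair M); split; first exact: corner_pair_bij.
by move=> r m; rewrite /= /corner_pair !corner_projZ.
Qed.

End CornerDecomposition.

Lemma corner_faithful (R : comPzRingType) (e : idempotent R) (M : lmodType R) :
  faithful M -> faithful (corner e M).
Proof.
move=> faithM a aM0; apply: corner_val_inj; rewrite corner_val0;
  apply: faithM => m.
rewrite -(corner_ring_valK a) mulrC -scalerA.
by rewrite -[LHS](corner_scaleE a (corner_proj e m)) [corner_scale _ _]aM0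
  corner_val0.
Qed.

Lemma corner_cyc (R : comPzRingType) (e : idempotent R) (M : lmodType R)
    (x : corner e M) : finite_set (cyc x) -> finite_set (cyc (corner_val x)).
Proof.
move=> fin; apply: (sub_finite_set _ (finite_image (@corner_val R e M) fin)).
move=> _ [r _ <-]; exists (corner_ring_proj e r *: x).
  by exists (corner_ring_proj e r).
rewrite [LHS]corner_scaleE -[corner_val _]/((e : R) * r).
by rewrite mulrC -scalerA corner_valK.
Qed.

(** * The structure of modules with finitely many submodules *)

(** The annihilator of a finite module has finite index; here it is 0. *)
Lemma faithful_finite_ring (R : comPzRingType) (M : lmodType R) :
  faithful M -> finite_set [set: M] -> finite_set [set: R].
Proof.
move=> faithM fin.
have [||S Sfin covS] := @cofinite_ann _ M setT; first exact: fin.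
  by move=> m _; exact: sub_finite_set fin.
apply: sub_finite_set Sfin => r _; have [s Ss /= rs] := covS r.
by rewrite -(subrK s r) (faithM _ (fun m => rs m I)) add0r.
Qed.

Lemma fms_image (R : comPzRingType) (M N : lmodType R) (v : {linear M -> N}) :
  bijective v -> is_FMS M -> is_FMS N.
Proof.
move=> [w _ wK] /is_FMSE fin; apply/is_FMSE.
apply: (finite_set_inj (f := fun K : set N => [set m | K (v m)]) fin).
  move=> K sK; split=> [|a m n /= Km Kn]; first by rewrite /= linear0;
    exact: sK.1.
  by rewrite /= linearP; exact: sK.2.
have image K : K = [set y | [set m | K (v m)] (w y)].
  by apply/funext => y; rewrite /= wK.
by move=> K K' _ _ e; rewrite (image K) (image K') e.
Qed.

Lemma faithful_cyclic_free (R : comPzRingType) (M : lmodType R) (x : M) :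
  faithful M -> (forall m, cyc x m) ->
  exists v : {linear M -> R^o}, bijective v.
Proof.
move=> faithM xM.
have x_inj (a b : R) : a *: x = b *: x -> a = b.
  move=> ab; apply/eqP; rewrite -subr_eq0; apply/eqP; apply: faithM => m.
  by have [r _ <-] := xM m;
    rewrite scalerA mulrC -scalerA scalerBl ab subrr scaler0.
have /choice[v vx] : forall m, exists a : R, a *: x = m.
  by move=> m; have [a _ <-] := xM m; exists a.
have v_lin : linear (v : M -> R^o).
  move=> a m n; apply: x_inj; rewrite vx scalerDl -[a *: (v m : R^o)]/(a * v m).
  by rewrite -scalerA !vx.
pose vL : {linear M -> R^o} :=
  HB.pack (v : M -> R^o) (GRing.isLinear.Build _ _ _ _ (v : M -> R^o) v_lin).
exists vL, (fun a : R => a *: x) => [m | a] /=; first exact: vx.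
by apply: x_inj; rewrite vx.
Qed.

(** Let M_f be the finite set of all elements spanning a finite submodule and A
    its annihilator, an ideal of finite index. There is a in 1 + A with aM
    finite, so inside M_f; then (1 - a)a kills M and a is idempotent. *)
Lemma fms_idempotent (R : comPzRingType) (M : lmodType R) :
  faithful M -> is_FMS M ->
  exists2 e : idempotent R, finite_set (range (fun m : M => (e : R) *: m)) &
    forall m : M, finite_set (cyc m) -> (e : R) *: m = m.
Proof.
move=> faithM fmsM.
pose A : set R^o :=
  [set r : R | forall m : M, finite_set (cyc m) -> r *: m = 0].
have sA : submodule A.
  split=> [m _|a b c /= Ab Ac m mfin]; first by rewrite scale0r.
  by rewrite scalerDl -scalerA Ab // Ac // scaler0 addr0.
have cofA : cofinite (A : set R).
  by apply: (@cofinite_ann _ M) => //; exact: fms_finite_cyc.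
have [a Aa afin] := fms_cofinite_ideal fmsM sA cofA.
have aa : a * a = a.
  apply/eqP; rewrite -subr_eq0 -opprB oppr_eq0 -{1}(mul1r a) -mulrBl; apply/eqP.
  apply: faithM => m; rewrite -scalerA; apply: Aa.
  apply: sub_finite_set afin => _ [r _ <-].
  by exists (r *: m) => //; rewrite !scalerA mulrC.
exists (Idempotent aa) => // m /Aa/eqP.
by rewrite scalerBl scale1r subr_eq0 => /eqP.
Qed.

Lemma fms_structure (R : comPzRingType) (M : lmodType R) :
  faithful M -> is_FMS M ->
  exists (R1 R2 : comPzRingType) (phi : {rmorphism R -> (R1 * R2)%type}),
    (is_FMIR R /\ bijective phi /\ finite_set [set: R1] /\
     (forall P : spec R2, infinite_set [set: spec_quot P])) /\
    (exists (M1 : lmodType R1) (M2 : lmodType R2),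
      module_is_prod phi M M1 M2 /\ finite_set [set: M1] /\
      rank_one_projective M2).
Proof.
move=> faithM fmsM; have [e eM_fin eK] := fms_idempotent faithM fmsM.
pose M1 : lmodType _ := corner e M.
pose M2 : lmodType _ := corner (idem_compl e) M.
have M1fin : finite_set [set: M1].
  apply: (finite_set_inj (f := @corner_val R e M) eM_fin) => [x _|x y _ _].
    by exists (corner_val x) => //; exact: corner_valK.
  exact: corner_val_inj.
have fmsM2 : is_FMS M2 := module_prod_fms_snd (corner_is_prod e M) fmsM.
have faithM2 : faithful M2 := corner_faithful faithM.
have M2_inf (x : M2) : finite_set (cyc x) -> x = 0.
  move/corner_cyc/eK => ex; apply: corner_val_inj.
  by rewrite corner_val0 -corner_valK /= scalerBl scale1r ex subrr.
have [x xM2] := fms_cyclic fmsM2 faithM2 M2_inf.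
have [v v_bij] := faithful_cyclic_free faithM2 xM2.
have phi_bij : bijective (corner_ring_pair e) := corner_pair_bij e R^o.
have R1fin : finite_set [set: corner_ring e].
  exact: (faithful_finite_ring (M := M1) (corner_faithful faithM) M1fin).
exists (corner_ring e), (corner_ring (idem_compl e)), (corner_ring_pair e).
split; [split; [|split=> //; split=> //] |].
- apply: (module_prod_fms phi_bij (regular_is_prod phi_bij) R1fin).
  exact: fms_image v_bij fmsM2.
- exact: (spec_quot_infinite fmsM2 faithM2 M2_inf).
exists M1, M2; split; first exact: corner_is_prod.
by split=> //; exact: free_rank_one_projective v_bij.
Qed.

Theorem theorem5p12 (R : comNzRingType) (M : lmodType R) (hM : faithful M) :
  is_FMS M <->
  exists (R1 R2 : comPzRingType) (phi : {rmorphism R -> (R1 * R2)%type}),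
    (is_FMIR R /\
     bijective phi /\
     finite_set [set: R1] /\
     (forall P : spec R2, infinite_set [set: spec_quot P])) /\
    (exists (M1 : lmodType R1) (M2 : lmodType R2),
      module_is_prod phi M M1 M2 /\
      finite_set [set: M1] /\
      rank_one_projective M2).
Proof.
split; first exact: fms_structure.
move=> [R1 [R2 [phi [[fmsR [phi_bij _]] [M1 [M2 [prodM [fin1 M2proj]]]]]]]].
apply: (module_prod_fms phi_bij prodM fin1).
have [genM2 _ rkM2] := M2proj.
apply: rank_one_fms => //.
exact: module_prod_fms_snd (regular_is_prod phi_bij) fmsR.
Qed.
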